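(* Let $S=\{(x,y)\in\mathbb{R}^n\times\mathbb{R}:\|x\|^2\le y\}$ and let $\Pi_S$ be the orthogonal projection onto $S$. For any point $(x_0,y_0)\in\mathbb{R}^n\times\mathbb{R}$, the projection is given by $$\Pi_S(x_0,y_0)=\begin{cases}(x_0,y_0), & \text{if }\|x_0\|^2\le y_0,\\[4pt] \left(\dfrac{x_0}{1+\mu^*},\ y_0+\dfrac{\mu^*}{2}\right), & \text{otherwise,}\end{cases}$$ where (in the second case) $\mu^*$ is the unique solution in the interval $[\max\{0,-2y_0\},\infty)$ of the univariate cubic equation $$\tfrac12\mu^3+(y_0+1)\mu^2+\left(2y_0+\tfrac12\right)\mu-x_0^Tx_0+y_0=0 .$$
   Context: $\|\cdot\|$ denotes the Euclidean norm. The orthogonal projection onto the closed convex set $S$ is $\Pi_S(x,y)=\operatorname{argmin}_{(x',y')\in S}\|(x',y')-(x,y)\|^2$, with the Euclidean norm on $\mathbb{R}^n\times\mathbb{R}$. *)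

(* Defs.v *)
From mathcomp Require Import all_boot all_order all_algebra.
From mathcomp Require Import boolp classical_sets reals.
Set Implicit Arguments.
Unset Strict Implicit.
Unset Printing Implicit Defensive.
Import Order.TTheory GRing.Theory Num.Theory.
Local Open Scope classical_set_scope.
Local Open Scope ring_scope.

(* The norms that MathComp-Analysis puts on matrices and on products are sup
   norms, so the Euclidean ones are defined here. *)
Definition enorm (R : realType) (n : nat) (x : 'cV[R]_n) : R :=
  Num.sqrt (\sum_(i < n) x i 0 ^+ 2).

Definition pnorm (R : realType) (n : nat) (z : 'cV[R]_n * R) : R :=
  Num.sqrt (enorm z.1 ^+ 2 + z.2 ^+ 2).

Definition argmin (R : realType) (T : Type) (S : set T) (f : T -> R) : set T :=
  [set p | S p /\ forall q, S q -> f p <= f q].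

Definition proj_argmin (R : realType) (n : nat) (S : set ('cV[R]_n * R))
    (z : 'cV[R]_n * R) : set ('cV[R]_n * R) :=
  argmin S (fun p => pnorm (p - z) ^+ 2).

(* Takes the junk value 0 when [proj_argmin S z] is empty, and is an arbitrary
   minimizer when there are several; it is the orthogonal projection exactly
   when [proj_argmin S z = [set proj S z]]. *)
Definition proj (R : realType) (n : nat) (S : set ('cV[R]_n * R))
    (z : 'cV[R]_n * R) : 'cV[R]_n * R :=
  xget 0 (proj_argmin S z).

Definition paraboloid (R : realType) (n : nat) : set ('cV[R]_n * R) :=
  [set z | enorm z.1 ^+ 2 <= z.2].

(* Main.v *)
Require Import Defs.
From mathcomp Require Import all_boot all_order all_algebra.
From mathcomp Require Import boolp classical_sets reals.
From mathcomp Require Import ring lra.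
Import Order.TTheory GRing.Theory Num.Theory.
Local Open Scope classical_set_scope.
Local Open Scope ring_scope.

(** The cubic is $(1+\mu)^2 (y_0 + \mu/2) = \|x_0\|^2$. Its left-hand side is
    strictly increasing on $[\max(0,-2y_0),\infty)$ and at most $\|x_0\|^2$ at
    the left endpoint, so it has exactly one root there. For this root put
    $p = (w, v)$ with $w = x_0/(1+\mu)$ and $v = y_0 + \mu/2$, so that
    $\|w\|^2 = v$ and $p - z = \mu(-w, 1/2)$ is a nonnegative multiple of an
    inward normal of $S$ at $p$. Hence $\|p-z\|^2 + \|q-p\|^2 \le \|q-z\|^2$
    for all $q$ in $S$, which makes $p$ the unique minimizer. *)

Lemma enorm_sqr (R : realType) (n : nat) (x : 'cV[R]_n) :
  enorm x ^+ 2 = \sum_(i < n) x i 0 ^+ 2.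
Proof. by rewrite sqr_sqrtr // sumr_ge0 // => i _; exact: sqr_ge0. Qed.

Lemma pnorm_sqr (R : realType) (n : nat) (z : 'cV[R]_n * R) :
  pnorm z ^+ 2 = enorm z.1 ^+ 2 + z.2 ^+ 2.
Proof. by rewrite sqr_sqrtr // addr_ge0 // sqr_ge0. Qed.

Lemma enorm_sqr_trmx (R : realType) (n : nat) (x : 'cV[R]_n) :
  enorm x ^+ 2 = (x^T *m x) 0 0.
Proof. by rewrite enorm_sqr mxE; apply: eq_bigr => i _; rewrite mxE expr2. Qed.

Lemma enorm_sqr_subZ (R : realType) (n : nat) (x w : 'cV[R]_n) (k : R) :
  enorm (x - k *: w) ^+ 2
  = enorm x ^+ 2 - 2 * k * (x^T *m w) 0 0 + k ^+ 2 * enorm w ^+ 2.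
Proof.
rewrite !enorm_sqr mxE !mulr_sumr -sumrB -big_split /=.
by apply: eq_bigr => i _; rewrite !mxE; ring.
Qed.

Lemma enormZ_sqr (R : realType) (n : nat) (x : 'cV[R]_n) (k : R) :
  enorm (k *: x) ^+ 2 = k ^+ 2 * enorm x ^+ 2.
Proof.
by rewrite !enorm_sqr mulr_sumr; apply: eq_bigr => i _; rewrite !mxE exprMn.
Qed.

Lemma pnorm_sqr_eq0 (R : realType) (n : nat) (z : 'cV[R]_n * R) :
  pnorm z ^+ 2 <= 0 -> z = 0.
Proof.
case: z => x y; rewrite pnorm_sqr /= => h.
have x2 := sqr_ge0 (enorm x); have y2 := sqr_ge0 y.
have y0 : y = 0 by apply/eqP; rewrite -sqrf_eq0; apply/eqP; lra.
have : enorm x ^+ 2 = 0 by lra.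
rewrite enorm_sqr => /eqP.
rewrite psumr_eq0; last by move=> i _; exact: sqr_ge0.
move=> /allP x0; rewrite y0; congr (_, _).
apply/colP => i; rewrite mxE; apply/eqP.
by rewrite -sqrf_eq0; apply: x0; rewrite mem_index_enum.
Qed.

(** The surplus [pnorm (q - p) ^+ 2] settles existence and uniqueness together: being nonnegative it
    makes [p] a minimizer, and comparing any minimizer [q] with [p] forces it to vanish. *)
Lemma proj_argmin_eq (R : realType) (n : nat) (S : set ('cV[R]_n * R))
    (z p : 'cV[R]_n * R) :
  S p ->
  (forall q, S q -> pnorm (p - z) ^+ 2 + pnorm (q - p) ^+ 2
                    <= pnorm (q - z) ^+ 2) ->
  proj_argmin S z = [set p].
Proof.
move=> Sp pyth; apply/seteqP; split=> [q [Sq qmin]|_ ->] /=.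
  have h1 := pyth q Sq; have h2 := qmin p Sp.
  by apply/eqP; rewrite -subr_eq0; apply/eqP/pnorm_sqr_eq0; lra.
split=> // q Sq; have h := pyth q Sq; have := sqr_ge0 (pnorm (q - p)); lra.
Qed.

Lemma proj_eq (R : realType) (n : nat) (S : set ('cV[R]_n * R))
    (z p : 'cV[R]_n * R) :
  proj_argmin S z = [set p] -> proj S z = p.
Proof. by rewrite /proj => ->; case: xgetP => // /(_ p)/(_ erefl). Qed.

(** With $p=(w,v)$, $q=(x,y)$ and $z$ the remaining point, right minus left is $2\langle
    p-z,q-p\rangle=\mu(y-2x^Tw+v)$. As $y\ge\|x\|^2$ and $v=\|w\|^2$, the bracket is at least
    $\|x-w\|^2$. *)
Lemma paraboloid_pythagoras (R : realType) (n : nat) (w : 'cV[R]_n) (v mu : R)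
    (q : 'cV[R]_n * R) :
  0 <= mu -> enorm w ^+ 2 = v -> @paraboloid R n q ->
  pnorm ((w, v) - ((1 + mu) *: w, v - mu / 2)) ^+ 2 + pnorm (q - (w, v)) ^+ 2
  <= pnorm (q - ((1 + mu) *: w, v - mu / 2)) ^+ 2.
Proof.
case: q => x y mu0 wv; rewrite /paraboloid /= => xy.
rewrite !pnorm_sqr /=.
have -> : w - (1 + mu) *: w = (- mu) *: w.
  by rewrite -[X in X - _]scale1r -scalerBl; congr (_ *: _); ring.
have := sqr_ge0 (enorm (x - w)).
(* Writing [w] as [1 *: w] lets [enorm_sqr_subZ] expand [x - w] as well as [x - (1 + mu) *: w]. *)
rewrite -[w in x - w]scale1r !enorm_sqr_subZ enormZ_sqr wv.
set A := enorm x ^+ 2 in xy *; set B := (x^T *m w) 0 0 => h.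
have : 0 <= mu * (y - 2 * B + v) by apply: mulr_ge0 => //; lra.
nra.
Qed.

(** The bounds on [m] make $1+m$ and $y_0+m/2$ nonnegative, so the factors can be raised one at a
    time: the square weakly, then the linear factor strictly. *)
Lemma cubic_increasing (R : realType) (y0 m m' : R) :
  0 <= m -> - 2 * y0 <= m -> m < m' ->
  (1 + m) ^+ 2 * (y0 + m / 2) < (1 + m') ^+ 2 * (y0 + m' / 2).
Proof.
move=> m0 m1 lt_mm'.
have le1 : (1 + m) ^+ 2 * (y0 + m / 2) <= (1 + m') ^+ 2 * (y0 + m / 2).
  by apply: ler_wpM2r; [lra | apply: lerXn2r; rewrite ?nnegrE; lra].
apply: le_lt_trans le1 _.
by rewrite ltr_pM2l ?exprn_gt0; lra.
Qed.

Lemma cubic_root (R : realType) (y0 a : R) :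
  0 <= a -> y0 < a ->
  exists m : R, [/\ 0 <= m, - 2 * y0 <= m
                  & (1 + m) ^+ 2 * (y0 + m / 2) = a].
Proof.
move=> a0 ya.
pose p : {poly R} := (1 + 'X) ^+ 2 * (y0%:P + 'X * (2^-1)%:P) - a%:P.
have pE m : p.[m] = (1 + m) ^+ 2 * (y0 + m / 2) - a by rewrite !hornerE.
pose l := Num.max 0 (- 2 * y0).
have l0 : 0 <= l by rewrite le_max lexx.
have l1 : - 2 * y0 <= l by rewrite le_max lexx orbT.
have pl : p.[l] <= 0.
  (* If $l=-2y_0$ the linear factor vanishes and the value is $-a$; if $l=0$ it is $y_0-a$. *)
  rewrite pE /l; case: (leP 0 (- 2 * y0)) => _; last lra.
  have -> : y0 + - 2 * y0 / 2 = 0 by field.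
  lra.
(* Since $y_0+l/2\ge 0$, the shift by $2a$ lifts the linear factor to at least $a$, and the square
   is at least 1. *)
pose u := l + 2 * a.
have pu : 0 <= p.[u].
  rewrite pE; have h : a <= y0 + u / 2 by rewrite /u; lra.
  have : 1 <= (1 + u) ^+ 2 by apply: exprn_ege1; rewrite /u; lra.
  nra.
have lu : l <= u by rewrite /u; lra.
have [|m /andP[lm _] /rootP] := @poly_ivt R p l u lu; first by rewrite pl pu.
rewrite pE => pm; exists m; split; last lra.
- exact: le_trans l0 lm.
- exact: le_trans l1 lm.
Qed.

Theorem theorem2p2 (R : realType) (n : nat) (x0 : 'cV[R]_n) (y0 : R) :
  let S := @paraboloid R n in
  [/\ proj_argmin S (x0, y0) = [set proj S (x0, y0)],
      enorm x0 ^+ 2 <= y0 -> proj S (x0, y0) = (x0, y0)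
    & ~ (enorm x0 ^+ 2 <= y0) ->
      exists mu : R,
        unique (fun m : R =>
          m \in `[Num.max 0 (- 2 * y0), +oo[ /\
          1 / 2 * m ^+ 3 + (y0 + 1) * m ^+ 2 + (2 * y0 + 1 / 2) * m
            - (x0^T *m x0) 0 0 + y0 = 0) mu /\
        proj S (x0, y0) = ((1 + mu)^-1 *: x0, y0 + mu / 2)].
Proof.
move=> S.
have [inS|/negP outS] := boolP (enorm x0 ^+ 2 <= y0).
  have argE : proj_argmin S (x0, y0) = [set (x0, y0)].
    (* Here $p=z$, so the required inequality is an equality with first term 0. *)
    apply: proj_argmin_eq => // q Sq.
    rewrite subrr; suff -> : pnorm (0 : 'cV[R]_n * R) ^+ 2 = 0 by rewrite add0r.
    rewrite pnorm_sqr enorm_sqr big1 ?expr0n ?addr0 // => i _.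
    by rewrite mxE expr0n.
  by rewrite (proj_eq _ _ _ _ _ argE); split=> // /(_ inS).
have x0y0 : y0 < enorm x0 ^+ 2 by rewrite ltNge; apply/negP.
have [mu [mu0 muy muE]] := cubic_root _ _ _ (sqr_ge0 (enorm x0)) x0y0.
have mu1 : 1 + mu != 0 by apply: lt0r_neq0; lra.
pose w := (1 + mu)^-1 *: x0; pose v := y0 + mu / 2.
(* The factored cubic says exactly that $(w,v)$ lies on the boundary of $S$. *)
have wv : enorm w ^+ 2 = v by rewrite enormZ_sqr -muE -/v; field.
have zE : (x0, y0) = ((1 + mu) *: w, v - mu / 2).
  by rewrite /w scalerA mulfV // scale1r /v addrK.
have argE : proj_argmin S (x0, y0) = [set (w, v)].
  apply: proj_argmin_eq => [|q Sq]; first by rewrite /S /paraboloid /= wv.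
  by rewrite zE; exact: paraboloid_pythagoras.
rewrite (proj_eq _ _ _ _ _ argE); split=> // _; exists mu; split=> //.
rewrite -enorm_sqr_trmx -muE; split.
  by rewrite in_itv /= andbT ge_max mu0 muy; split=> //; field.
move=> m [+ mE]; rewrite in_itv /= andbT ge_max => /andP[m0 my].
(* Any other root gives the factored cubic the same value $\|x_0\|^2$, which strict monotonicity
   excludes. *)
have {}mE : (1 + m) ^+ 2 * (y0 + m / 2) = (1 + mu) ^+ 2 * (y0 + mu / 2).
  by apply/eqP; rewrite -subr_eq0 -mE; apply/eqP; field.
have [lt|lt|//] := ltgtP mu m.
- by have := cubic_increasing _ _ _ _ mu0 muy lt; rewrite mE ltxx.
- by have := cubic_increasing _ _ _ _ m0 my lt; rewrite mE ltxx.
Qed.
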